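(* For every $n\ge 1$ and every partition $\lambda\vdash n$, one has $$\dim_{\mathrm{loc}}(\lambda)=\begin{cases}0, & \lambda=(1),\\ \max\bigl(1,s(\lambda),t(\lambda)\bigr), & n\ge 2.\end{cases}$$ Equivalently, for every integer $r\ge 2$, $$\dim_{\mathrm{loc}}(\lambda)\ge r\iff s(\lambda)\ge r\ \text{ or }\ t(\lambda)\ge r.$$
   Context: For $n\ge 1$, the partition graph $G_n$ is the simple graph whose vertices are the integer partitions of $n$; two distinct partitions are adjacent if one is obtained from the other by an elementary transfer of one unit from one part to another, followed by reordering. The receiving part may be a part equal to $0$ (i.e. the unit may form a new part of size $1$), and a part reduced to $0$ is deleted. $K_n=\mathrm{Cl}(G_n)$ is the clique complex of $G_n$: its simplices are the nonempty cliques of $G_n$, and a clique with $d+1$ vertices is a simplex of dimension $d$. For a vertex $\lambda$ of $G_n$, the local simplex dimension $\dim_{\mathrm{loc}}(\lambda)$ is the maximum of $\dim\sigma$ over all simplices $\sigma$ of $K_n$ containing $\lambda$; equivalently, $\dim_{\mathrm{loc}}(\lambda)=d$ iff the largest clique of $G_n$ containing $\lambda$ has cardinality $d+1$. Identify a partition with its Ferrers diagram. $\mathrm{Rem}(\lambda)$ is the set of removable corners of $\lambda$ (cells of the diagram whose removal leaves the diagram of a partition) and $\mathrm{Add}(\lambda)$ is the set of addable corners (cells not in the diagram whose addition gives the diagram of a partition). For $c\in\mathrm{Rem}(\lambda)$ and $a\in\mathrm{Add}(\lambda)$, $\lambda(c\to a)$ is the diagram obtained by removing the cell $c$ and adding the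 cell $a$; the transfer is admissible if the resulting diagram is again the diagram of a partition and is different from $\lambda$. Star and top capacities: if $n=1$, set $s((1))=t((1))=0$. If $n\ge 2$, put $A_{\max}(\lambda,c)=\{a\in\mathrm{Add}(\lambda):\lambda(c\to a)\text{ is admissible}\}$ for $c\in\mathrm{Rem}(\lambda)$, and $C_{\max}(\lambda,a)=\{c\in\mathrm{Rem}(\lambda):\lambda(c\to a)\text{ is admissible}\}$ for $a\in\mathrm{Add}(\lambda)$; then $$s(\lambda)=\max_{c\in\mathrm{Rem}(\lambda)}|A_{\max}(\lambda,c)|,\qquad t(\lambda)=\max_{a\in\mathrm{Add}(\lambda)}|C_{\max}(\lambda,a)|.$$ *)

(* Defs.v *)
From HB Require Import structures.
From mathcomp Require Import all_boot.

Set Implicit Arguments.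
Unset Strict Implicit.
Unset Printing Implicit Defensive.

Definition is_intpart (n : nat) (s : seq nat) : bool :=
  [&& sorted geq s, 0 \notin s & sumn s == n].

Record intpart (n : nat) : predArgType :=
  IntPart { parts :> seq nat; _ : is_intpart n parts }.

HB.instance Definition _ n := [isSub for @parts n].
HB.instance Definition _ n := [Countable of intpart n by <:].

Section IntpartFinite.
Variable n : nat.

Lemma leq_mem_sumn (s : seq nat) (x : nat) : x \in s -> x <= sumn s.
Proof.
elim: s => //= y s IHs; rewrite inE => /predU1P[-> | /IHs les].
  exact: leq_addr.
exact: leq_trans les (leq_addl _ _).
Qed.

Lemma leq_size_sumn (s : seq nat) : 0 \notin s -> size s <= sumn s.
Proof.
elim: s => //= y s IHs; rewrite inE negb_or eq_sym -lt0n => /andP[y0 /IHs les].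
by rewrite -add1n leq_add.
Qed.

Let code (lam : intpart n) : n.-bseq 'I_n.+1 :=
  insub_bseq n [seq inord x | x <- lam].

Let decode (b : n.-bseq 'I_n.+1) : option (intpart n) :=
  insub [seq nat_of_ord i | i <- b].

Lemma intpart_codeK : pcancel code decode.
Proof.
move=> lam; rewrite /decode /code; have /and3P[_ p0 /eqP sn] := valP lam.
have szn : size [seq inord x : 'I_n.+1 | x <- lam] <= n.
  by rewrite size_map -[leqRHS]sn leq_size_sumn.
rewrite (_ : map _ _ = parts lam) ?valK //.
rewrite -[bseqval _]/(val (insub_bseq n _)) insubdK // -map_comp.
rewrite -[RHS]map_id; apply/eq_in_map => x xl /=.
by rewrite inordK // ltnS -[leqRHS]sn leq_mem_sumn.
Qed.

HB.instance Definition _ : isFinite (intpart n) := PCanIsFinite intpart_codeK.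

End IntpartFinite.

(* One unit moves from the part of index [i] to the part of index [j]. For
   [j = size s], [incr_nth] turns the implicit zero part into a new part 1. *)
Definition transfer (s : seq nat) (i j : nat) : seq nat :=
  sort geq [seq x <- incr_nth (set_nth 0 s i (nth 0 s i).-1) j | 0 < x].

Definition transferable (s t : seq nat) : bool :=
  [exists i : 'I_(size s), exists j : 'I_(size s).+1,
     (nat_of_ord i != j) && (transfer s i j == t)].

Definition padj (n : nat) : rel (intpart n) := fun lam mu =>
  (lam != mu) && (transferable lam mu || transferable mu lam).

Definition is_clique (T : finType) (e : rel T) (S : {set T}) : bool :=
  [forall x in S, forall y in S, (x != y) ==> e x y].

Definition is_simplex (T : finType) (e : rel T) (S : {set T}) : bool :=
  (S != set0) && is_clique e S.

Definition simplex_dim (T : finType) (S : {set T}) : nat := #|S|.-1.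

(* The range is never empty, as it contains [[set lam]]. *)
Definition dim_loc (n : nat) (lam : intpart n) : nat :=
  \max_(S : {set intpart n} | is_simplex (@padj n) S && (lam \in S))
    simplex_dim S.

(* Cells are pairs (row, column), counted from 0. This box contains the diagram
   of every partition of an integer at most n.+1, hence all addable corners of
   partitions of n. *)
Definition cell (n : nat) := ('I_n.+1 * 'I_n.+1)%type.

Definition diagram (n : nat) (s : seq nat) : {set cell n} :=
  [set c : cell n | c.2 < nth 0 s c.1].

(* The size of the partition is forced to be the number of cells of [D], so no
   part of the diagram of [mu] can lie outside the box. *)
Definition is_diagram (n : nat) (D : {set cell n}) : bool :=
  [exists mu : intpart #|D|, D == diagram n mu].

Section Corners.
Variables (n : nat) (lam : intpart n).

Definition Rem : {set cell n} :=
  [set c in diagram n lam | is_diagram (diagram n lam :\ c)].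

Definition Add : {set cell n} :=
  [set a in ~: diagram n lam | is_diagram (a |: diagram n lam)].

Definition move_cell (c a : cell n) : {set cell n} :=
  a |: (diagram n lam :\ c).

Definition admissible (c a : cell n) : bool :=
  is_diagram (move_cell c a) && (move_cell c a != diagram n lam).

Definition Amax (c : cell n) : {set cell n} :=
  [set a in Add | admissible c a].

Definition Cmax (a : cell n) : {set cell n} :=
  [set c in Rem | admissible c a].

Definition star_cap : nat :=
  if n == 1 then 0 else \max_(c in Rem) #|Amax c|.

Definition top_cap : nat :=
  if n == 1 then 0 else \max_(a in Add) #|Cmax a|.

End Corners.

(* Main.v *)
Require Import Defs.
From mathcomp Require Import all_boot zify.

(** The partition graph is an induced subgraph of a Johnson graph, and the
    theorem is the description of the cliques of a Johnson graph read off
    through this embedding.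

    The diagrams of the partitions of [n] are exactly the down-closed sets of
    [n] cells ([is_diagramP], [downset_intpart]), and two partitions are adjacent
    if and only if each of their diagrams has exactly one cell outside the other
    ([padjE]). One direction compares column heights: the height of column [k]
    is the number of parts greater than [k], which does not depend on the order
    of the parts, so a transfer lowers one column by one cell and raises another
    one, whatever reordering follows ([count_transfer]). The other direction
    compares row lengths: the exchanged cells lie in different rows, and the
    indices of these rows are those of the transfer ([diff_transferable]).
    As intersections and unions of down-closed sets are down-closed, the cells
    exchanged along an edge are a removable and an addable corner
    ([padj_exchange]).

    So a neighbour of [lam] is a pair (removed cell, added cell), and two
    neighbours are adjacent only if their pairs agree in one coordinate
    ([exchange_diff]). Pairs that pairwise agree in a coordinate all agree in
    the same one ([pairwise_agree]): if [p] and [q] differ in the first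
    coordinate, they share the second, and a pair whose second coordinate is
    another one would have to share its first with both. Hence a clique
    through [lam] consists of [lam] and neighbours that remove a common corner
    or add a common corner, at most [star_cap lam] or [top_cap lam] of them
    ([dim_loc_le]). Conversely all neighbours obtained from a fixed removed, or
    from a fixed added corner form a clique with [lam] ([star_dim_loc],
    [top_dim_loc]). Therefore the local dimension is the larger capacity; the
    1 in the formula is harmless because [lam] has a neighbour as soon as
    [1 < n] ([dim_loc_gt0]). *)

(** * Sequences of parts, row lengths and column heights *)

Lemma geq_trans : transitive geq.
Proof. by move=> y x z /= yx zy; apply: leq_trans yx. Qed.

Lemma nth_sorted_geq {s : seq nat} {i j : nat} :
  sorted geq s -> i <= j -> nth 0 s j <= nth 0 s i.
Proof.
move=> ss ij; case: (ltnP j (size s)) => [js|]; last by move/(nth_default 0) ->.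
by apply: (@sorted_leq_nth _ geq geq_trans leqnn 0 s ss i j); rewrite ?inE; lia.
Qed.

(** Conjugation: both sides say that the cell in row [i] and column [k] lies in
    the diagram, the left one by the length of its row, the right one by the
    height of its column. *)
Lemma nth_gt_count (s : seq nat) (i k : nat) :
  sorted geq s -> (k < nth 0 s i) = (i < count (ltn k) s).
Proof.
elim: s i => [|x s IHs] i /=; first by rewrite nth_nil.
rewrite (path_sortedE geq_trans) => /andP[/allP xs ss].
case: (ltnP k x) => kx; first by case: i => [|i] //=; rewrite IHs.
have -> : count (ltn k) s = 0.
  apply/eqP; rewrite -leqn0 leqNgt -has_count; apply/hasPn => y /xs /= yx.
  by rewrite -leqNgt (leq_trans yx).
rewrite addn0 ltn0; case: i => [|i] /=; first by rewrite ltnNge kx.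
apply/negbTE; rewrite -leqNgt; case: (ltnP i (size s)) => [si|].
  exact: leq_trans (xs _ (mem_nth 0 si)) kx.
by move/(nth_default 0) ->.
Qed.

Lemma nth_filter_pos (s : seq nat) (i : nat) :
  sorted geq s -> nth 0 [seq x <- s | 0 < x] i = nth 0 s i.
Proof.
elim: s i => [|x s IHs] i //=.
rewrite (path_sortedE geq_trans) => /andP[/allP xs ss].
case: posnP => [x0|_]; last by case: i => [|i] //=; rewrite IHs.
rewrite IHs //; have z j : nth 0 s j = 0.
  case: (ltnP j (size s)) => [sj|]; last exact: nth_default.
  by have := xs _ (mem_nth 0 sj); rewrite x0 /= leqn0 => /eqP.
by rewrite z; case: i => [|i] /=.
Qed.

(** Sequences that agree up to the default value 0 differ only by trailing
    zeros, which the filter deletes. *)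
Lemma eq_nth_filter_pos (s t : seq nat) :
  nth 0 s =1 nth 0 t -> [seq x <- s | 0 < x] = [seq x <- t | 0 < x].
Proof.
elim: s t => [|x s IHs] t st.
  suff /all_pred1P -> : all (pred1 0) t by elim: (size t).
  by apply/(all_nthP 0) => i _; rewrite /= -st nth_nil.
case: t st => [|y t] st.
  suff /all_pred1P -> : all (pred1 0) (x :: s) by elim: (size (x :: s)).
  by apply/(all_nthP 0) => i _; rewrite /= st nth_nil.
have /= -> := st 0; by rewrite (IHs t) // => i; apply: (st i.+1).
Qed.

Lemma filter_pos_id (s : seq nat) : 0 \notin s -> [seq x <- s | 0 < x] = s.
Proof.
by move=> s0; apply/all_filterP/allP => x xs; rewrite lt0n; apply: contraNneq s0 => <-.
Qed.

Lemma sumn_filter_pos (s : seq nat) : sumn [seq x <- s | 0 < x] = sumn s.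
Proof. by elim: s => //= x s IHs; case: posnP => [->|_] /=; rewrite IHs. Qed.

Lemma incr_nth_set_nth (s : seq nat) (i : nat) :
  incr_nth s i = set_nth 0 s i (nth 0 s i).+1.
Proof.
by elim: s i => [|x s IHs] [|i] //=; rewrite ?IHs // nth_nil.
Qed.

(** The effect of a transfer on column heights: a part [x] that becomes [x.-1]
    loses its cell in column [x.-1], and a part [y] that becomes [y.+1] gains one
    in column [y]. Heights are counts, so the final sorting is invisible. *)
Lemma count_transfer (s : seq nat) (i j k : nat) :
  i < size s -> i != j -> 0 < nth 0 s i ->
  count (ltn k) (transfer s i j) + (k == (nth 0 s i).-1)
    = count (ltn k) s + (k == nth 0 s j).
Proof.
move=> si ij s_i; rewrite /transfer (permP (permEl (perm_sort _ _))).
rewrite count_filter.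
rewrite (eq_count (a2 := ltn k)) => [|x /=]; last first.
  by case: x => [|x]; rewrite /= ?andbT.
(* The counts after the two updates are given by truncated subtractions; the
   next three bounds on the initial count show that these are exact. *)
rewrite incr_nth_set_nth !count_set_nthF // !nth_set_nth /= eq_sym (negbTE ij).
have : k < nth 0 s i -> 0 < count (ltn k) s.
  by rewrite -has_count => ki; apply/hasP; exists (nth 0 s i); rewrite ?mem_nth.
have : k < nth 0 s j -> k < nth 0 s i -> 1 < count (ltn k) s.
  move=> kj ki; have sj : j < size s.
    by case: (ltnP j (size s)) kj => // /(nth_default 0) ->.
  have := count_set_nth_ltn (ltn k) 0 0 si.
  have : 0 < count (ltn k) (set_nth 0 s i 0).
    rewrite -has_count; apply/hasP; exists (nth 0 s j) => //.
    apply/(nthP 0); exists j; first by rewrite size_set_nth leq_max sj orbT.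
    by rewrite nth_set_nth /= eq_sym (negbTE ij).
  by rewrite /= ki; lia.
have : k < nth 0 s j -> 0 < count (ltn k) s.
  move=> kj; have sj : j < size s.
    by case: (ltnP j (size s)) kj => // /(nth_default 0) ->.
  by rewrite -has_count; apply/hasP; exists (nth 0 s j); rewrite ?mem_nth.
set c := count _ _; move: (nth 0 s i) (nth 0 s j) c s_i => x y c.
rewrite /=.
by case: (ltnP k x); case: (ltnP k y); case: (ltnP k x.-1); case: (ltnP k y.+1); lia.
Qed.

Lemma transfer_intpart (n : nat) (lam : intpart n) (i j : nat) :
  i < size lam -> i != j -> is_intpart n (transfer lam i j).
Proof.
have /and3P[_ p0 /eqP sn] := valP lam => si ij.
have s_i : 0 < nth 0 lam i.
  by rewrite lt0n; apply: contraNneq p0 => <-; rewrite mem_nth.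
apply/and3P; split.
- by apply: sort_sorted => x y /=; apply: leq_total.
- by rewrite mem_sort mem_filter.
- rewrite /transfer (perm_sumn (permEl (perm_sort _ _))) sumn_filter_pos.
  rewrite incr_nth_set_nth !sumn_set_nth0 nth_set_nth /= [j == i]eq_sym (negbTE ij).
  have := leq_mem_sumn (mem_nth 0 si); rewrite /= in sn *; lia.
Qed.

(** A transfer from value [x] to value [y] permutes the parts when [y = x.-1].
    This is avoided by moving a unit from the last row to the first one, or to a
    new row if there is a single row. *)
Lemma transfer_nontrivial (n : nat) (lam : intpart n) :
  1 < n -> exists i j,
    [/\ i < size lam, j <= size lam, i != j & nth 0 lam j != (nth 0 lam i).-1].
Proof.
have /and3P[/= ss p0 /eqP /= sn] := valP lam => n1.
case: (ltnP 1 (size lam)) => s1.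
  have ls : (size lam).-1 < size lam by case: (size _) s1.
  exists (size lam).-1, 0; split => //; first by case: (size _) s1 => [|[]].
  have : nth 0 lam (size lam).-1 <= nth 0 lam 0 by apply: nth_sorted_geq.
  have : 0 < nth 0 lam (size lam).-1.
    by rewrite lt0n; apply: contraNneq p0 => <-; rewrite mem_nth.
  lia.
exists 0, 1; move: s1 sn; case: (parts lam) => [|x [|y s]] //=; split; lia.
Qed.

(** * Diagrams as down-closed sets of cells *)

Definition downset {n : nat} (D : {set cell n}) : Prop :=
  forall c d : cell n, d.1 <= c.1 -> d.2 <= c.2 -> c \in D -> d \in D.

Lemma card_ord_lt (m k : nat) : k <= m -> #|[set j : 'I_m | j < k]| = k.
Proof.
move=> km; rewrite -sum1dep_card (big_ord_narrow km).
by rewrite sum1_card card_ord.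
Qed.

Lemma mem_initial (m : nat) (A : {set 'I_m}) (k : 'I_m) :
  (forall i j : 'I_m, i <= j -> j \in A -> i \in A) ->
  (k \in A) = (k < #|A|).
Proof.
move=> dA; apply/idP/idP => [kA|].
  rewrite -[X in X <= _](card_ord_lt m k.+1 (ltn_ord k)); apply/subset_leq_card/subsetP => j.
  by rewrite inE ltnS => jk; apply: dA kA.
apply: contraTT => kA; rewrite -leqNgt -[leqRHS](card_ord_lt m k (ltnW (ltn_ord k))).
apply/subset_leq_card/subsetP => j jA; rewrite inE ltnNge.
by apply: contraNN kA => kj; apply: dA jA.
Qed.

Lemma card_cells (n : nat) (D : {set cell n}) :
  #|D| = \sum_(i < n.+1) #|[set k | (i, k) \in D]|.
Proof.
transitivity (\sum_(i < n.+1) \sum_(k < n.+1 | (i, k) \in D) 1).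
  rewrite pair_big_dep /= -sum1_card.
  by apply: eq_bigl => -[i k] /=.
by apply: eq_bigr => i _; rewrite sum1dep_card.
Qed.

Lemma sumn_nth (s : seq nat) (m : nat) :
  size s <= m -> sumn s = \sum_(i < m) nth 0 s i.
Proof.
move=> sm; rewrite sumnE (big_nth 0) big_mkord (big_ord_widen m (nth 0 s)) //.
rewrite big_mkcond; apply: eq_bigr => i _.
by case: ltnP => // /(nth_default 0) ->.
Qed.

Lemma card_diagram (n : nat) (s : seq nat) :
  size s <= n.+1 -> {in s, forall x, x <= n.+1} -> #|diagram n s| = sumn s.
Proof.
move=> sn sx; rewrite card_cells (sumn_nth _ _ sn); apply: eq_bigr => i _.
rewrite -[RHS](@card_ord_lt n.+1); last first.
  case: (ltnP i (size s)) => [si|]; last by move/(nth_default 0) ->.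
  by apply: sx; rewrite mem_nth.
by apply: eq_card => k; rewrite !inE.
Qed.

Lemma diagram_downset (n : nat) (s : seq nat) :
  sorted geq s -> downset (diagram n s).
Proof.
move=> ss c d h1 h2; rewrite !inE => cs.
apply: leq_ltn_trans h2 _; apply: leq_trans cs _; exact: nth_sorted_geq.
Qed.

(** From a down-closed set, the partition is recovered as the list of its row
    sizes: every row is an initial segment, and lower rows are contained in
    upper ones. *)
Lemma is_diagramP (n : nat) (D : {set cell n}) :
  reflect (downset D) (is_diagram D).
Proof.
apply: (iffP existsP) => [[mu /eqP ->]|dD].
  by apply: diagram_downset; have /and3P[] := valP mu.
pose row (i : 'I_n.+1) := [set k | (i, k) \in D].
pose s := [seq #|row i| | i <- enum 'I_n.+1].
have nths (i : 'I_n.+1) : nth 0 s i = #|row i|.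
  by rewrite (nth_map ord0) ?size_enum_ord // nth_ord_enum.
have ss : sorted geq s.
  apply/(sortedP 0) => i; rewrite size_map size_enum_ord => iN.
  rewrite /= (nths (Ordinal iN)) (nths (Ordinal (ltnW iN))).
  apply/subset_leq_card/subsetP => k; rewrite !inE.
  by apply: dD => /=.
have P : is_intpart #|D| [seq x <- s | 0 < x].
  apply/and3P; split; first by apply: (sorted_filter geq_trans).
    by rewrite mem_filter.
  rewrite sumn_filter_pos sumnE big_map big_enum /= card_cells.
  by apply/eqP/eq_bigr.
exists (IntPart P); apply/eqP/setP => -[i k]; rewrite inE /= nth_filter_pos //.
rewrite nths -mem_initial ?inE // => j l jl; rewrite !inE.
by apply: dD => /=.
Qed.

Lemma card_diagram_intpart (n : nat) (lam : intpart n) : #|diagram n lam| = n.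
Proof.
have /and3P[ss p0 /eqP sn] := valP lam.
rewrite card_diagram //; first by rewrite ltnW // ltnS -[leqRHS]sn leq_size_sumn.
by move=> x /leq_mem_sumn; rewrite /= in sn *; rewrite sn => /leqW.
Qed.

Lemma intpart_downset (n : nat) (lam : intpart n) : downset (diagram n lam).
Proof. by apply: diagram_downset; have /and3P[] := valP lam. Qed.

Lemma nth_eq_intpart (n : nat) (lam mu : intpart n) :
  nth 0 lam =1 nth 0 mu -> lam = mu.
Proof.
have /and3P[_ l0 _] := valP lam; have /and3P[_ m0 _] := valP mu => e.
by apply/val_inj; rewrite /= -(filter_pos_id _ l0) -(filter_pos_id _ m0) (eq_nth_filter_pos _ _ e).
Qed.

Lemma nth_intpart_le (n : nat) (lam : intpart n) i : nth 0 lam i <= n.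
Proof.
have /and3P[_ _ /eqP sn] := valP lam.
case: (ltnP i (size lam)) => [si|]; last by move/(nth_default 0) ->.
by rewrite -[leqRHS]sn leq_mem_sumn // mem_nth.
Qed.

Lemma size_intpart_le (n : nat) (lam : intpart n) : size lam <= n.
Proof. by have /and3P[_ p0 /eqP sn] := valP lam; rewrite -[leqRHS]sn leq_size_sumn. Qed.

Lemma diagram_inj (n : nat) : injective (fun lam : intpart n => diagram n lam).
Proof.
suff le (lam mu : intpart n) i :
    diagram n lam = diagram n mu -> nth 0 lam i <= nth 0 mu i.
  by move=> lam mu e; apply: nth_eq_intpart => i; apply/eqP; rewrite eqn_leq !le.
move=> e; have := nth_intpart_le n lam i.
(* The last cell of row [i] of [lam] also lies in the diagram of [mu]. *)
case E : (nth 0 lam i) => [|k] //; rewrite -ltnS => kn; have {}kn := ltnW kn.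
have iN : i < n.+1.
  have := size_intpart_le n lam; case: (ltnP i (size lam)) => [|/(nth_default 0)]; last by rewrite E.
  lia.
have : ((Ordinal iN, Ordinal kn) : cell n) \in diagram n lam by rewrite inE /= E.
by rewrite e inE.
Qed.

Lemma downset_intpart (n : nat) (D : {set cell n}) :
  #|D| = n -> is_diagram D -> exists mu : intpart n, diagram n mu = D.
Proof.
move=> Dn /existsP[[s Ps] /eqP e]; have Ps' := Ps; rewrite Dn in Ps'.
by exists (IntPart Ps').
Qed.

(** * Exchanging one element of a set *)

Definition exchange {T : finType} (D : {set T}) (c a : T) : {set T} :=
  a |: (D :\ c).

Section Exchange.
Context {T : finType} {D : {set T}}.

Lemma exchange_diff (c a c' a' : T) :
  c \in D -> c' \in D -> a \notin D -> a' \notin D ->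
  #|exchange D c a :\: exchange D c' a'| <= 1 -> c = c' \/ a = a'.
Proof.
move=> cD c'D aD a'D /card_le1_eqP le1.
case: (eqVneq c c') => [|cc']; first by left.
case: (eqVneq a a') => [|aa']; first by right.
have ac' : c' != a by apply: contraNneq aD => <-.
have a'c' : c' != a' by apply: contraNneq a'D => <-.
have c'c : c' != c by rewrite eq_sym.
suff /eqP : c' = a by rewrite (negbTE ac').
by apply: le1; rewrite !inE ?eqxx ?(negbTE ac') ?(negbTE a'c') ?(negbTE aa')
  ?(negbTE c'c) ?(negbTE aD) ?c'D ?andbF.
Qed.

Lemma exchange_star (c a a' : T) :
  a \notin D -> a != a' -> exchange D c a :\: exchange D c a' = [set a].
Proof.
move=> aD aa'; apply/setP => x; rewrite !inE.
case: (eqVneq x a) => [->|xa] /=; first by rewrite (negbTE aa') (negbTE aD) andbF.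
by case: (x == c); case: (x \in D); rewrite ?andbF ?orbT.
Qed.

Lemma exchange_top (c c' a : T) :
  c' \in D -> a \notin D -> c != c' ->
  exchange D c a :\: exchange D c' a = [set c'].
Proof.
move=> c'D aD cc'; apply/setP => x; rewrite !inE.
case: (eqVneq x c') => [->|xc'] /=.
  rewrite c'D [c' == c]eq_sym cc' andbT orbF orbT andbT.
  by apply: contraNneq aD => <-.
by case: (x == a); case: (x \in D); rewrite ?andbF.
Qed.

Lemma setD_exchange (c a : T) :
  c \in D -> a \notin D -> D :\: exchange D c a = [set c].
Proof.
move=> cD aD; apply/setP => x; rewrite !inE.
case: (eqVneq x c) => [->|xc] /=; last by case: (x \in D); rewrite ?orbT ?andbF.
by rewrite cD orbF andbT; apply: contraNneq aD => <-.
Qed.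

Lemma exchange_setD (c a : T) :
  a \notin D -> exchange D c a :\: D = [set a].
Proof.
move=> aD; apply/setP => x; rewrite !inE.
case: (eqVneq x a) => [->|_] /=; first by rewrite aD.
by case: (x \in D); rewrite ?andbF.
Qed.

Lemma card_exchange (c a : T) :
  c \in D -> a \notin D -> #|exchange D c a| = #|D|.
Proof. by move=> cD aD; rewrite cardsU1 (cardsD1 c D) cD !inE (negbTE aD) andbF. Qed.

Lemma diff1_exchange (E : {set T}) (c a : T) :
  D :\: E = [set c] -> E :\: D = [set a] -> E = exchange D c a.
Proof.
move=> /setP Dc /setP Ea; apply/setP => x; have := Dc x; have := Ea x.
by rewrite !inE; case: (x \in E); case: (x \in D) => /= <- <-.
Qed.

End Exchange.

(** Whether the cliques of the Johnson graph are of star or of top type is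
    decided here. Once [f x <> f y], the value of [g] at [x] and [y] is common,
    and no [z] can have another one: it would satisfy [f z = f x] and
    [f z = f y]. *)
Lemma pairwise_agree {T : finType} {R1 R2 : eqType} (S : {set T})
    (f : T -> R1) (g : T -> R2) :
  {in S &, forall x y, f x = f y \/ g x = g y} ->
  {in S &, forall x y, f x = f y} \/ {in S &, forall x y, g x = g y}.
Proof.
move=> fg; case: (boolP [forall x in S, forall y in S, f x == f y]) => [/forall_inP fS|].
  by left=> x y xS yS; apply/eqP; move/forall_inP: (fS x xS); apply.
case/forall_inPn => x xS /forall_inPn[y yS fxy]; right.
have gxy : g x = g y by case: (fg x y xS yS) => // /eqP; rewrite (negbTE fxy).
have gx z : z \in S -> g z = g x.
  move=> zS; case: (fg z x zS xS) => // fzx.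
  case: (fg z y zS yS) => [fzy|-> //].
  by rewrite -fzx -fzy eqxx in fxy.
by move=> z t zS tS; rewrite !gx.
Qed.

(** * Adjacency of partitions *)

Section Graph.
Context {n : nat}.
Implicit Types lam mu nu : intpart n.
Local Notation D := (diagram n).

Lemma card_diffC lam mu : #|D lam :\: D mu| = #|D mu :\: D lam|.
Proof. by rewrite !cardsD setIC !card_diagram_intpart. Qed.

Lemma mem_diagram_col lam (c : cell n) :
  (c \in D lam) = (c.1 < count (ltn c.2) lam).
Proof. by rewrite inE nth_gt_count //; have /and3P[] := valP lam. Qed.

(** Only the column that loses a cell can stick out of the new diagram, and only
    by its top cell. *)
Lemma transferable_diff lam mu :
  transferable lam mu -> #|D lam :\: D mu| <= 1.
Proof.
case/existsP => i /existsP[j /andP[ij /eqP tr]].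
have s_i : 0 < nth 0 lam i.
  have /and3P[_ p0 _] := valP lam.
  by rewrite lt0n; apply: contraNneq p0 => <-; rewrite mem_nth.
have col k := count_transfer lam i j k (ltn_ord i) ij s_i.
rewrite tr in col; pose k := (nth 0 lam i).-1.
have key (c : cell n) : c \in D lam :\: D mu ->
    c.1 = count (ltn k) mu :> nat /\ c.2 = k :> nat.
  rewrite in_setD !mem_diagram_col; case: c => r l /=; have := col l; rewrite -/k.
  by case: (eqVneq (l : nat) k) => [->|_]; lia.
apply/card_le1_eqP => -[r l] [r' l'] /key[/= r1 l1] /key[/= r2 l2].
by congr pair; apply: val_inj; rewrite /= ?r1 ?r2 ?l1 ?l2.
Qed.

Lemma diff_eq0 lam mu : (#|D lam :\: D mu| == 0) = (lam == mu).
Proof.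
rewrite cards_eq0 setD_eq0; apply/idP/eqP => [sub|->]; last exact: subxx.
by apply/diagram_inj/eqP; rewrite eqEcard sub !card_diagram_intpart leqnn.
Qed.

(** The row lengths determined by an exchange, written additively to avoid
    truncated subtraction. *)
Lemma nth_diff lam mu (c a : cell n) (r : nat) :
  D lam :\: D mu = [set c] -> D mu :\: D lam = [set a] ->
  nth 0 lam r + (a.1 == r :> nat) = nth 0 mu r + (c.1 == r :> nat).
Proof.
have row nu (i : 'I_n.+1) : nth 0 nu i = #|pair i @^-1: D nu|.
  rewrite -[LHS](card_ord_lt n.+1) ?(leqW (nth_intpart_le _ _ _)) //.
  by apply: eq_card => k; rewrite !inE.
have row1 (i : 'I_n.+1) (d : cell n) : #|pair i @^-1: [set d]| = (d.1 == i).
  case: d => d1 d2 /=; case: (eqVneq d1 i) => [->|di].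
    by apply/eqP/cards1P; exists d2; apply/setP => k; rewrite !inE xpair_eqE eqxx.
  by apply: eq_card0 => k; rewrite !inE xpair_eqE eq_sym (negbTE di).
move=> Dc Da; case: (ltnP r n.+1) => rn.
  rewrite -[r]/(val (Ordinal rn)) !row -![(_ == _ :> nat)]/(_ == _ :> 'I_n.+1).
  rewrite -!row1 -Dc -Da !preimsetD.
  have e nu nu' := cardsID (pair (Ordinal rn) @^-1: D nu')
    (pair (Ordinal rn) @^-1: D nu).
  by rewrite -(e lam mu) -(e mu lam) setIC addnAC.
have z nu : nth 0 nu r = 0.
  by rewrite nth_default // (leq_trans (size_intpart_le _ _)) // ltnW.
by rewrite !z !ltn_eqF // (leq_trans (ltn_ord _)).
Qed.

(** The unit moves between the rows of the two exchanged cells. They are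
    different rows, since otherwise all rows would keep their length. *)
Lemma diff_transferable lam mu :
  #|D lam :\: D mu| = 1 -> transferable lam mu.
Proof.
move=> e; have /eqP/cards1P[c Dc] := e.
have /eqP/cards1P[a Da] : #|D mu :\: D lam| = 1 by rewrite card_diffC.
have rows r := nth_diff lam mu c a r Dc Da.
have : c \in D lam :\: D mu by rewrite Dc set11.
have : a \in D mu :\: D lam by rewrite Da set11.
rewrite !inE => /andP[_ a_mu] /andP[_ c_lam].
have ca : c.1 != a.1.
  apply: contra_eq_neq e => ca; rewrite (_ : lam = mu) ?setDv ?cards0 //.
  by apply: nth_eq_intpart => r; have := rows r; rewrite ca => /addIn.
have ci : c.1 < size lam.
  rewrite ltnNge; apply: contraTN c_lam => /(nth_default 0) ->.
  by rewrite ltn0.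
(* A receiving row beyond the first empty one would leave a gap in [mu]. *)
have aj : a.1 < (size lam).+1.
  rewrite ltnS leqNgt; apply/negP => sa.
  have /and3P[ms _ _] := valP mu.
  have := rows (size lam); rewrite nth_default // (gtn_eqF sa).
  have := nth_sorted_geq ms (ltnW sa); rewrite /=; lia.
apply/existsP; exists (Ordinal ci); apply/existsP; exists (Ordinal aj).
rewrite /= -[(_ != _ :> nat)]/(c.1 != a.1) ca /=; apply/eqP.
have /and3P[ms m0 _] := valP mu.
rewrite /transfer -[RHS](sorted_sort geq_trans ms) -[in RHS](filter_pos_id _ m0).
congr sort; apply: eq_nth_filter_pos => r.
rewrite nth_incr_nth nth_set_nth /=; have := rows r.
case: (eqVneq r c.1) => [->|_]; last by rewrite addn0 addnC.
by case: (nth 0 lam c.1) c_lam => // x _; rewrite addSn addn1 addnC => -[].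
Qed.

Lemma padjE lam mu : padj lam mu = (#|D lam :\: D mu| == 1).
Proof.
apply/andP/eqP => [[]|e].
  rewrite -diff_eq0 => ne tr.
  have : #|D lam :\: D mu| <= 1.
    by case/orP: tr => /transferable_diff //; rewrite card_diffC.
  by case: #|_| ne => [|[]].
by split; [rewrite -diff_eq0 e | rewrite (diff_transferable lam mu e)].
Qed.

(** The cell [c] is removable because [D lam :\ c] is the intersection of the two
    diagrams, and [a] is addable because [a |: D lam] is their union. *)
Lemma padj_exchange lam mu :
  padj lam mu ->
  exists c a, [/\ c \in Rem lam, a \in Add lam, admissible lam c a
                & D mu = exchange (D lam) c a].
Proof.
rewrite padjE => e; have /cards1P[c Dc] := e.
have /cards1P[a Da] : #|D mu :\: D lam| == 1 by rewrite card_diffC.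
have Dmu := diff1_exchange _ _ _ Dc Da; exists c, a.
have Dl := intpart_downset n lam; have Dm := intpart_downset n mu.
have : c \in D lam :\: D mu by rewrite Dc set11.
have : a \in D mu :\: D lam by rewrite Da set11.
rewrite !in_setD => /andP[a_l a_m] /andP[c_m c_l]; split=> //.
- rewrite !inE in c_l *; rewrite c_l; apply/is_diagramP.
  rewrite -Dc setDDr setDv set0U => x y h1 h2.
  by rewrite !in_setI => /andP[xl xm]; rewrite (Dl x y) // (Dm x y).
- rewrite !inE in a_l *; rewrite a_l; apply/is_diagramP.
  rewrite -Da => x y h1 h2; rewrite !in_setU !in_setD.
  case: (boolP (y \in D lam)) => //= yl; rewrite orbF.
  case: (boolP (x \in D lam)) => /= [xl _|_]; first by rewrite (Dl x y) in yl.
  by rewrite orbF; apply: Dm.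
- rewrite /admissible -[move_cell lam c a]Dmu; apply/andP; split.
    exact/is_diagramP.
  by apply: contraNneq c_m => ->.
Qed.

(** * Cliques through a partition *)

Lemma admissible_intpart lam (c a : cell n) :
  c \in D lam -> a \notin D lam -> admissible lam c a ->
  exists mu, D mu = exchange (D lam) c a.
Proof.
move=> cD aD /andP[isD _]; apply: downset_intpart => //.
by rewrite card_exchange // card_diagram_intpart.
Qed.

(** Lower bounds on the local dimension can be stated with sets of cells only:
    [F] is transported back to partitions along the injective map to diagrams. *)
Lemma clique_dim_loc lam (F : {set {set cell n}}) :
  D lam \in F -> {in F, forall A, exists mu, D mu = A} ->
  {in F &, forall A B, A != B -> #|A :\: B| = 1} -> #|F|.-1 <= dim_loc lam.
Proof.
move=> lF FD F1; pose S := [set mu : intpart n | D mu \in F].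
have -> : #|F| = #|S|.
  rewrite -(card_imset _ (diagram_inj n)); apply: eq_card => A.
  apply/idP/imsetP => [AF|[mu]]; last by rewrite inE => muF ->.
  by have [mu muA] := FD _ AF; exists mu; rewrite ?inE muA.
apply: (leq_bigmax_cond (F := fun S => simplex_dim S) S).
have lS : lam \in S by rewrite inE.
rewrite lS andbT; apply/andP; split; first by apply/set0Pn; exists lam.
apply/forall_inP => mu; rewrite inE => muF; apply/forall_inP => nu.
rewrite inE => nuF; apply/implyP => ne; rewrite padjE F1 //.
by rewrite (inj_eq (diagram_inj n)).
Qed.

Lemma star_dim_loc lam : \max_(c in Rem lam) #|Amax lam c| <= dim_loc lam.
Proof.
apply/bigmax_leqP => c; rewrite inE => /andP[cD _].
pose F := D lam |: [set exchange (D lam) c a | a in Amax lam c].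
have AmaxD a : a \in Amax lam c -> a \notin D lam /\ admissible lam c a.
  by rewrite inE => /andP[]; rewrite inE in_setC => /andP[].
have -> : #|Amax lam c| = #|F|.-1.
  rewrite cardsU1 card_in_imset => [|a b /AmaxD[aD _] /AmaxD[bD _] ab].
    case: imsetP => // -[a /AmaxD[aD _]] e.
    by have := setD_exchange c a cD aD; rewrite -e setDv => /setP/(_ c); rewrite !inE eqxx.
  by apply: set1_inj; rewrite -(exchange_setD c a aD) ab exchange_setD.
apply: clique_dim_loc; first exact: setU11.
  move=> A /setU1P[->|/imsetP[a /AmaxD[aD adm] ->]]; first by exists lam.
  exact: admissible_intpart.
move=> A B /setU1P[->|/imsetP[a /AmaxD[aD _] ->]] /setU1P[->|/imsetP[b /AmaxD[bD _] ->]].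
- by rewrite eqxx.
- by rewrite setD_exchange // cards1.
- by rewrite exchange_setD // cards1.
- move=> ne; rewrite exchange_star ?cards1 //.
  by apply: contraNneq ne => ->.
Qed.

Lemma top_dim_loc lam : \max_(a in Add lam) #|Cmax lam a| <= dim_loc lam.
Proof.
apply/bigmax_leqP => a; rewrite inE in_setC => /andP[aD _].
pose F := D lam |: [set exchange (D lam) c a | c in Cmax lam a].
have CmaxD c : c \in Cmax lam a -> c \in D lam /\ admissible lam c a.
  by rewrite inE => /andP[]; rewrite inE => /andP[].
have -> : #|Cmax lam a| = #|F|.-1.
  rewrite cardsU1 card_in_imset => [|c d /CmaxD[cD _] /CmaxD[dD _] cd].
    case: imsetP => // -[c /CmaxD[cD _]] e.
    by have := setD_exchange c a cD aD; rewrite -e setDv => /setP/(_ c); rewrite !inE eqxx.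
  by apply: set1_inj; rewrite -(setD_exchange c a cD aD) cd setD_exchange.
apply: clique_dim_loc; first exact: setU11.
  move=> A /setU1P[->|/imsetP[c /CmaxD[cD adm] ->]]; first by exists lam.
  exact: admissible_intpart.
move=> A B /setU1P[->|/imsetP[c /CmaxD[cD _] ->]] /setU1P[->|/imsetP[d /CmaxD[dD _] ->]].
- by rewrite eqxx.
- by rewrite setD_exchange // cards1.
- by rewrite exchange_setD // cards1.
- move=> ne; rewrite exchange_top ?cards1 //.
  by apply: contraNneq ne => ->.
Qed.

(** The removed and added cells of the neighbours are encoded by the differences
    [f] and [g] with [D lam], both singletons, so that [pairwise_agree] applies
    without choosing cells. The neighbours then inject into the set of exchanges
    with the common corner. *)
Lemma dim_loc_le lam :
  dim_loc lam <= maxn (\max_(c in Rem lam) #|Amax lam c|)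
                      (\max_(a in Add lam) #|Cmax lam a|).
Proof.
apply/bigmax_leqP => S /andP[/andP[_ /forall_inP clq] lS].
have adj : {in S &, forall mu nu, mu != nu -> padj mu nu}.
  by move=> mu nu muS nuS; apply/implyP; move/forall_inP: (clq _ muS); apply.
pose S' := S :\ lam.
have -> : simplex_dim S = #|S'| by rewrite /simplex_dim (cardsD1 lam S) lS.
have ex mu : mu \in S' -> exists c a,
    [/\ c \in Rem lam, a \in Add lam, admissible lam c a & D mu = exchange (D lam) c a].
  by rewrite !inE eq_sym => /andP[ne muS]; apply: padj_exchange; apply: adj.
have RemD c : c \in Rem lam -> c \in D lam by rewrite inE => /andP[].
have AddD a : a \in Add lam -> a \notin D lam by rewrite inE in_setC => /andP[].
have [mu0 mu0S|S0] := pickP (mem S'); last by rewrite eq_card0.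
have [c0 [a0 [c0R a0A adm0 e0]]] := ex mu0 mu0S.
pose f mu := D lam :\: D mu; pose g mu := D mu :\: D lam.
have fg : {in S' &, forall mu nu, f mu = f nu \/ g mu = g nu}.
  move=> mu nu muS nuS; case: (eqVneq mu nu) => [->|ne]; first by left.
  have : padj mu nu by apply: adj => //; [case/setD1P: muS | case/setD1P: nuS].
  have [c [a [/RemD cD /AddD aD _ e]]] := ex mu muS.
  have [c' [a' [/RemD c'D /AddD a'D _ e']]] := ex nu nuS.
  rewrite padjE /f /g e e' !setD_exchange // !exchange_setD // => /eqP e1.
  have [|->|->] := exchange_diff c a c' a' cD c'D aD a'D; rewrite ?e1 //; by [left | right].
rewrite leq_max -(card_imset (mem S') (diagram_inj n)).
have [fS|gS] := pairwise_agree S' f g fg; apply/orP; [left|right].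
- apply: leq_trans (leq_bigmax_cond c0 c0R).
  apply: leq_trans (leq_imset_card (exchange (D lam) c0) _).
  apply/subset_leq_card/subsetP => _ /imsetP[nu nuS ->].
  have [c [a [cR aA adm e]]] := ex nu nuS.
  have := fS _ _ mu0S nuS; rewrite /f e0 e !setD_exchange; try by [exact: RemD | exact: AddD].
  move=> /set1_inj cc.
  by apply/imsetP; exists a; [rewrite in_set cc aA | rewrite cc].
- apply: leq_trans (leq_bigmax_cond a0 a0A).
  apply: leq_trans (leq_imset_card (exchange (D lam) ^~ a0) _).
  apply/subset_leq_card/subsetP => _ /imsetP[nu nuS ->].
  have [c [a [cR aA adm e]]] := ex nu nuS.
  have := gS _ _ mu0S nuS; rewrite /g e0 e !exchange_setD; try exact: AddD.
  move=> /set1_inj aa.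
  by apply/imsetP; exists c; [rewrite in_set aa cR | rewrite aa].
Qed.

Lemma dim_loc_gt0 lam : 1 < n -> 0 < dim_loc lam.
Proof.
move=> n1; have [i [j [si sj ij ne]]] := transfer_nontrivial n lam n1.
pose mu := IntPart (transfer_intpart n lam i j si ij).
have s_i : 0 < nth 0 lam i.
  have /and3P[_ p0 _] := valP lam.
  by rewrite lt0n; apply: contraNneq p0 => <-; rewrite mem_nth.
have lm : lam != mu.
  apply: contraNneq ne => e.
  (* If the transfer fixed [lam], column [nth 0 lam j] would keep its height,
     although it gains a cell and loses none. *)
  have := count_transfer lam i j (nth 0 lam j) si ij s_i.
  by rewrite -[transfer _ _ _]/(parts mu) -e eqxx => /addnI; case: eqP.
have adj : #|D lam :\: D mu| = 1.
  apply/eqP; rewrite -padjE /padj lm; apply/orP; left.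
  by apply/existsP; exists (Ordinal si); apply/existsP; exists (Ordinal (sj : j < _.+1)); rewrite /= ij eqxx.
have -> : 1 = #|[set D lam; D mu]|.-1.
  by rewrite cards2 (inj_eq (diagram_inj n)) lm.
apply: clique_dim_loc; first exact: set21.
  by move=> A /set2P[] ->; eexists.
by move=> A B /set2P[] -> /set2P[] ->; rewrite ?eqxx // card_diffC.
Qed.

End Graph.

(** * The local dimension *)

Lemma dim_loc_capacities (n : nat) (lam : intpart n) :
  n != 1 -> dim_loc lam = maxn (star_cap lam) (top_cap lam).
Proof.
move=> n1; rewrite /star_cap /top_cap (negbTE n1).
by apply/eqP; rewrite eqn_leq dim_loc_le geq_max star_dim_loc top_dim_loc.
Qed.

Lemma intpart1_unique (lam mu : intpart 1) : lam = mu.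
Proof.
suff H (nu : intpart 1) : parts nu = [:: 1] by apply: val_inj; rewrite /= !H.
have /and3P[/= _ p0 /eqP] := valP nu.
case: (parts nu) p0 => [|[|[|x]] s] //=.
rewrite inE => /= s0 [s1]; congr (_ :: _); apply: size0nil.
by apply/eqP; rewrite -leqn0 -s1 leq_size_sumn.
Qed.

Lemma dim_loc1 (lam : intpart 1) : dim_loc lam = 0.
Proof.
apply/eqP; rewrite -leqn0; apply/bigmax_leqP => S _.
have : #|S| <= 1 by apply/card_le1_eqP => mu nu _ _; apply: intpart1_unique.
by rewrite /simplex_dim; case: #|S| => [|[]].
Qed.

Theorem proposition3p4 (n : nat) (n_ge1 : 1 <= n) (lam : intpart n) :
  [/\ parts lam = [:: 1] -> dim_loc lam = 0,
      2 <= n -> dim_loc lam = maxn 1 (maxn (star_cap lam) (top_cap lam))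
    & forall r : nat, 2 <= r ->
        (r <= dim_loc lam <-> (r <= star_cap lam \/ r <= top_cap lam))].
Proof.
split=> [l1|n2|r r2].
- have /and3P[_ _] := valP lam; rewrite /= l1 /= => /eqP e.
  by move: lam {l1}; rewrite -e; apply: dim_loc1.
- rewrite -dim_loc_capacities; last by rewrite gtn_eqF.
  by apply/esym/maxn_idPr/dim_loc_gt0.
- case: (eqVneq n 1) => [e|n1].
    move: lam; rewrite e => lam; rewrite dim_loc1 /star_cap /top_cap /=.
    by split=> [|[]] h; case: r r2 h.
  rewrite dim_loc_capacities // leq_max.
  by split=> [/orP|h]; last apply/orP.
Qed.
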